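(* Let $\lambda\in\mathbb{C}$ with $\lambda(\lambda^6-1)\neq0$, let $X_1=F_{1,\lambda}$, $Y_1=F_{2,\lambda}$, $X_2=F_{3,\lambda}$, $Y_2=F_{4,\lambda}$ and $A=p_{1,\lambda}$, and define the rational functions $$X_3=\frac{A(X_1-X_2)+Y_1Y_2(X_2Y_1-X_1Y_2)}{(X_1^2X_2+Y_1^2Y_2)-(X_1X_2^2+Y_1Y_2^2)},\qquad Y_3=\frac{A(Y_1-Y_2)+X_1X_2(X_1Y_2-X_2Y_1)}{(X_1^2X_2+Y_1^2Y_2)-(X_1X_2^2+Y_1Y_2^2)}.$$ Then $X_3=F_{5,\lambda}$ and $Y_3=F_{6,\lambda}$.
   Context: $\omega=e^{2\pi i/3}$. $F_{1,\lambda}=\lambda^3x^2-xy+\lambda^3y^2$, $F_{2,\lambda}=-\lambda x^2+\lambda^4xy-\lambda y^2$, $F_{3,\lambda}=\lambda^3\omega^2x^2-xy+\lambda^3\omega y^2$, $F_{4,\lambda}=-\lambda\omega^2x^2+\lambda^4xy-\lambda\omega y^2$, $F_{5,\lambda}=\lambda^3\omega x^2-xy+\lambda^3\omega^2y^2$, $F_{6,\lambda}=-\lambda\omega x^2+\lambda^4xy-\lambda\omega^2y^2$, and $p_{1,\lambda}=(\lambda^6-1)(\lambda^3x^3+y^3)(x^3+\lambda^3y^3)$; one has $F_{1,\lambda}^3+F_{2,\lambda}^3=F_{3,\lambda}^3+F_{4,\lambda}^3=F_{5,\lambda}^3+F_{6,\lambda}^3=p_{1,\lambda}$. The formulas for $(X_3,Y_3)$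 are the chord construction of the third point on the curve $X^3+Y^3=A$ through $(X_1,Y_1),(X_2,Y_2)$. *)

(* Defs.v *)
From HB Require Import structures.
From mathcomp Require Import all_boot all_order all_algebra.
From mathcomp Require Import fraction complex mpoly.
From mathcomp Require Import reals sequences exp trigo.

Set Implicit Arguments.
Unset Strict Implicit.
Unset Printing Implicit Defensive.

Import Order.TTheory GRing.Theory Num.Theory.
Local Open Scope ring_scope.
Local Open Scope complex_scope.

(* The complex exponential, e^(a + i b) = e^a (cos b + i sin b). *)
Definition cexp (R : realType) (z : R[i]) : R[i] :=
  (expR (complex.Re z))%:C * (cos (complex.Im z) +i* sin (complex.Im z)).

Definition omega (R : realType) : R[i] := cexp (2 * pi%:C * 'i%C / 3).

Section Forms.
Variables (R : realType) (lam : R[i]).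

Local Notation w := (omega R).
Local Notation x := ('X_ord0 : {mpoly R[i][2]}).
Local Notation y := ('X_ord_max : {mpoly R[i][2]}).

Definition F1 : {mpoly R[i][2]} :=
  lam ^+ 3 *: x ^+ 2 - x * y + lam ^+ 3 *: y ^+ 2.

Definition F2 : {mpoly R[i][2]} :=
  - lam *: x ^+ 2 + lam ^+ 4 *: (x * y) - lam *: y ^+ 2.

Definition F3 : {mpoly R[i][2]} :=
  (lam ^+ 3 * w ^+ 2) *: x ^+ 2 - x * y + (lam ^+ 3 * w) *: y ^+ 2.

Definition F4 : {mpoly R[i][2]} :=
  - (lam * w ^+ 2) *: x ^+ 2 + lam ^+ 4 *: (x * y) - (lam * w) *: y ^+ 2.

Definition F5 : {mpoly R[i][2]} :=
  (lam ^+ 3 * w) *: x ^+ 2 - x * y + (lam ^+ 3 * w ^+ 2) *: y ^+ 2.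

Definition F6 : {mpoly R[i][2]} :=
  - (lam * w) *: x ^+ 2 + lam ^+ 4 *: (x * y) - (lam * w ^+ 2) *: y ^+ 2.

Definition p1 : {mpoly R[i][2]} :=
  (lam ^+ 6 - 1) *: ((lam ^+ 3 *: x ^+ 3 + y ^+ 3)
                     * (x ^+ 3 + lam ^+ 3 *: y ^+ 3)).

End Forms.

(* Main.v *)
(* Since [w = omega] satisfies [w^2 + w + 1 = 0], the chord formulas, cleared of
   denominators, are polynomial identities modulo that relation.  The common
   denominator is a nonzero polynomial because at [(x, y) = (1, 0)] it takes the
   value [lam^3 (lam^6 - 1) (w^2 - w)], and [(w^2 - w)^2 = - 3]. *)
Require Import Defs.
From HB Require Import structures.
From mathcomp Require Import all_boot all_order all_algebra.
From mathcomp Require Import fraction complex mpoly.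
From mathcomp Require Import reals sequences exp trigo.
From mathcomp Require Import ring lra.

Set Implicit Arguments.
Unset Strict Implicit.
Unset Printing Implicit Defensive.

Import Order.TTheory GRing.Theory Num.Theory.
Local Open Scope ring_scope.
Local Open Scope complex_scope.

(** Since 3t = 2 pi, the triple-angle formula makes [cos t] a root of 4c^3 - 3c - 1 = (c - 1)(2c +
    1)^2, so only the root 1 has to be excluded. *)
Lemma cos_2pi3 (R : realType) : cos (2 * pi / 3) = - (1 / 2) :> R.
Proof.
have pi0 := pi_gt0 R; set t := 2 * pi / 3.
have c3 : 4 * cos t ^+ 3 - 3 * cos t = 1.
  rewrite -[RHS](cos2pi R) (_ : pi *+ 2 = t *+ 2 + t); last by rewrite /t; field.
  rewrite cosD cos_mulr2n sin_mulr2n.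
  ring: (sin2cos2 t).
have : (cos t - 1) * (2 * cos t + 1) ^+ 2 = 0.
  by transitivity (4 * cos t ^+ 3 - 3 * cos t - 1); [ring | rewrite c3 subrr].
move/eqP; rewrite mulf_eq0 sqrf_eq0 subr_eq0 => /orP[/eqP c1|/eqP]; last by lra.
(* Cosine decreases strictly on [0, pi] and 0 < t < pi. *)
have : cos t < cos 0.
  by rewrite ltr_cos ?in_itv /= ?lexx ?ltW // /t; lra.
by rewrite c1 cos0 ltxx.
Qed.

Lemma omegaE (R : realType) :
  omega R = cos (2 * pi / 3) +i* sin (2 * pi / 3).
Proof.
have -> : omega R = cexp (0 +i* (2 * pi / 3)).
  congr cexp.
  (* Multiplying by 3 removes the complex division and leaves one real equation for each of the real
     and imaginary parts. *)
  have n3 : (3 : R[i]) != 0 by rewrite pnatr_eq0.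
  apply: (mulIf n3); rewrite divfK //.
  by apply/eqP; rewrite eq_complex /=; apply/andP; split; apply/eqP; field.
by rewrite /cexp /= expR0 mul1r.
Qed.

(** With cosine -1/2 and sine s, the imaginary part is 2(-1/2)s + s = 0, and the real part needs
    only s^2 = 3/4, which the Pythagorean identity supplies. *)
Lemma omega_cyclotomic (R : realType) : omega R ^+ 2 + omega R + 1 = 0.
Proof.
rewrite omegaE; have := cos2Dsin2 (2 * pi / 3 : R); rewrite cos_2pi3.
move: (sin _) => s s2.
by apply/eqP; rewrite eq_complex /=; apply/andP; split; apply/eqP; lra.
Qed.

Section ChordIdentities.
Variables (K : comRingType) (l w x y : K).
Hypothesis w2 : w ^+ 2 + w + 1 = 0.

Let X1 := l ^+ 3 * x ^+ 2 - x * y + l ^+ 3 * y ^+ 2.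
Let Y1 := - l * x ^+ 2 + l ^+ 4 * (x * y) - l * y ^+ 2.
Let X2 := l ^+ 3 * w ^+ 2 * x ^+ 2 - x * y + l ^+ 3 * w * y ^+ 2.
Let Y2 := - (l * w ^+ 2) * x ^+ 2 + l ^+ 4 * (x * y) - l * w * y ^+ 2.
Let X3 := l ^+ 3 * w * x ^+ 2 - x * y + l ^+ 3 * w ^+ 2 * y ^+ 2.
Let Y3 := - (l * w) * x ^+ 2 + l ^+ 4 * (x * y) - l * w ^+ 2 * y ^+ 2.
Let A := (l ^+ 6 - 1) * ((l ^+ 3 * x ^+ 3 + y ^+ 3) * (x ^+ 3 + l ^+ 3 * y ^+ 3)).
Let D := X1 ^+ 2 * X2 + Y1 ^+ 2 * Y2 - (X1 * X2 ^+ 2 + Y1 * Y2 ^+ 2).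

(** Substituting -w - 1 for w^2 brings both sides to degree at most one in w, where they agree as
    polynomials in l, x, y. A general commutative ring is used so that l and w can later be constant
    polynomials. *)
Lemma chord_numX : A * (X1 - X2) + Y1 * Y2 * (X2 * Y1 - X1 * Y2) = X3 * D.
Proof.
have w2E : w ^+ 2 = - w - 1 by rewrite -[LHS]subr0 -w2; ring.
rewrite /D /A /X1 /X2 /X3 /Y1 /Y2; ring: w2E.
Qed.

Lemma chord_numY : A * (Y1 - Y2) + X1 * X2 * (X1 * Y2 - X2 * Y1) = Y3 * D.
Proof.
have w2E : w ^+ 2 = - w - 1 by rewrite -[LHS]subr0 -w2; ring.
rewrite /D /A /X1 /X2 /Y1 /Y2 /Y3; ring: w2E.
Qed.

End ChordIdentities.

Lemma forms_chord (R : realType) (lam : R[i]) :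
  let D := F1 lam ^+ 2 * F3 lam + F2 lam ^+ 2 * F4 lam
    - (F1 lam * F3 lam ^+ 2 + F2 lam * F4 lam ^+ 2) in
  p1 lam * (F1 lam - F3 lam)
    + F2 lam * F4 lam * (F3 lam * F2 lam - F1 lam * F4 lam) = F5 lam * D /\
  p1 lam * (F2 lam - F4 lam)
    + F1 lam * F3 lam * (F1 lam * F4 lam - F3 lam * F2 lam) = F6 lam * D.
Proof.
have w2 : (omega R)%:MP_[2] ^+ 2 + (omega R)%:MP_[2] + 1 = 0.
  by rewrite -rmorphXn -mpolyC1 -!mpolyCD omega_cyclotomic mpolyC0.
pose l := lam%:MP_[2]; pose w := (omega R)%:MP_[2].
pose x : {mpoly R[i][2]} := 'X_ord0; pose y : {mpoly R[i][2]} := 'X_ord_max.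
(* Each scaling becomes multiplication by a constant polynomial, and the constant embedding is
   distributed over products and powers, to match the shape of the abstract identities. *)
have -> : F1 lam = l ^+ 3 * x ^+ 2 - x * y + l ^+ 3 * y ^+ 2.
  by rewrite /F1 -!mul_mpolyC !rmorphXn.
have -> : F2 lam = - l * x ^+ 2 + l ^+ 4 * (x * y) - l * y ^+ 2.
  by rewrite /F2 -!mul_mpolyC mpolyCN !rmorphXn.
have -> : F3 lam = l ^+ 3 * w ^+ 2 * x ^+ 2 - x * y + l ^+ 3 * w * y ^+ 2.
  by rewrite /F3 -!mul_mpolyC !(mpolyCM 2 (lam ^+ 3)) !rmorphXn.
have -> : F4 lam =
    - (l * w ^+ 2) * x ^+ 2 + l ^+ 4 * (x * y) - l * w * y ^+ 2.
  by rewrite /F4 -!mul_mpolyC mpolyCN !(mpolyCM 2 lam (omega R))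
    !(mpolyCM 2 lam (omega R ^+ 2)) !rmorphXn.
have -> : F5 lam = l ^+ 3 * w * x ^+ 2 - x * y + l ^+ 3 * w ^+ 2 * y ^+ 2.
  by rewrite /F5 -!mul_mpolyC !(mpolyCM 2 (lam ^+ 3)) !rmorphXn.
have -> : F6 lam =
    - (l * w) * x ^+ 2 + l ^+ 4 * (x * y) - l * w ^+ 2 * y ^+ 2.
  by rewrite /F6 -!mul_mpolyC mpolyCN !(mpolyCM 2 lam (omega R))
    !(mpolyCM 2 lam (omega R ^+ 2)) !rmorphXn.
have -> : p1 lam = (l ^+ 6 - 1) *
    ((l ^+ 3 * x ^+ 3 + y ^+ 3) * (x ^+ 3 + l ^+ 3 * y ^+ 3)).
  by rewrite /p1 -!mul_mpolyC mpolyCB mpolyC1 !rmorphXn.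
split; [exact: chord_numX | exact: chord_numY].
Qed.

Lemma chord_den_neq0 (R : realType) (lam : R[i]) :
  lam * (lam ^+ 6 - 1) != 0 ->
  F1 lam ^+ 2 * F3 lam + F2 lam ^+ 2 * F4 lam
    - (F1 lam * F3 lam ^+ 2 + F2 lam * F4 lam ^+ 2) != 0.
Proof.
move=> hlam; pose v (i : 'I_2) : R[i] := (i == ord0)%:R.
(* At the point (1, 0) each form reduces to its coefficient of x^2. *)
have v1F : (F1 lam).@[v] = lam ^+ 3.
  by rewrite /F1 !expr2 !(mevalB, mevalD, mevalM, mevalZ, mevalXU) /v /=; ring.
have v2F : (F2 lam).@[v] = - lam.
  by rewrite /F2 !expr2 !(mevalB, mevalD, mevalM, mevalZ, mevalXU) /v /=; ring.
have v3F : (F3 lam).@[v] = lam ^+ 3 * omega R ^+ 2.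
  by rewrite /F3 !expr2 !(mevalB, mevalD, mevalM, mevalZ, mevalXU) /v /=; ring.
have v4F : (F4 lam).@[v] = - (lam * omega R ^+ 2).
  by rewrite /F4 !expr2 !(mevalB, mevalD, mevalM, mevalZ, mevalXU) /v /=; ring.
move: (F1 lam) (F2 lam) (F3 lam) (F4 lam) v1F v2F v3F v4F.
move=> f1 f2 f3 f4 v1F v2F v3F v4F; apply/eqP => /(congr1 (meval v)).
rewrite meval0 !expr2 !(mevalB, mevalD, mevalM) v1F v2F v3F v4F.
have w2 := omega_cyclotomic R; move: (omega R) w2 => w w2.
have w2E : w ^+ 2 = - w - 1 by rewrite -[LHS]subr0 -w2; ring.
move=> D0.
(* The value of the denominator, grouped so that the hypothesis cancels the middle factor; what is
   left forces w^2 = w. *)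
have : lam ^+ 2 * (lam * (lam ^+ 6 - 1)) * (w ^+ 2 - w) = 0.
  by rewrite -[RHS]D0; ring: w2E.
move/eqP; rewrite mulf_eq0 [X in X || _]mulf_eq0 (negPf hlam) orbF.
have lam0 : lam != 0 by apply: contraNneq hlam => ->; rewrite mul0r.
rewrite sqrf_eq0 (negPf lam0) /= => /eqP d0.
have : (3 : R[i]) = - (w ^+ 2 - w) ^+ 2 by ring: w2E.
by rewrite d0 expr0n oppr0 => /eqP; rewrite pnatr_eq0.
Qed.

Theorem theorem7p3 (R : realType) (lam : R[i])
    (hlam : lam * (lam ^+ 6 - 1) != 0) :
  let X1 : {fraction {mpoly R[i][2]}} := tofrac (F1 lam) in
  let Y1 : {fraction {mpoly R[i][2]}} := tofrac (F2 lam) in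
  let X2 : {fraction {mpoly R[i][2]}} := tofrac (F3 lam) in
  let Y2 : {fraction {mpoly R[i][2]}} := tofrac (F4 lam) in
  let A : {fraction {mpoly R[i][2]}} := tofrac (p1 lam) in
  let X3 := (A * (X1 - X2) + Y1 * Y2 * (X2 * Y1 - X1 * Y2)) /
    ((X1 ^+ 2 * X2 + Y1 ^+ 2 * Y2) - (X1 * X2 ^+ 2 + Y1 * Y2 ^+ 2)) in
  let Y3 := (A * (Y1 - Y2) + X1 * X2 * (X1 * Y2 - X2 * Y1)) /
    ((X1 ^+ 2 * X2 + Y1 ^+ 2 * Y2) - (X1 * X2 ^+ 2 + Y1 * Y2 ^+ 2)) in
  X3 = tofrac (F5 lam) /\ Y3 = tofrac (F6 lam).
Proof.
have D0 := chord_den_neq0 hlam; have [] := forms_chord lam.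
move: (F1 lam) (F2 lam) (F3 lam) (F4 lam) (F5 lam) (F6 lam) (p1 lam) D0.
move=> f1 f2 f3 f4 f5 f6 a D0 eX eY X1 Y1 X2 Y2 A X3 Y3.
(* The embedding into the fraction field is an injective ring morphism, so nonvanishing carries over
   from polynomials. *)
have DF0 : X1 ^+ 2 * X2 + Y1 ^+ 2 * Y2 - (X1 * X2 ^+ 2 + Y1 * Y2 ^+ 2) != 0.
  by rewrite -!(tofracXn, tofracM, tofracD, tofracB) tofrac_eq0.
(* Once the denominator is cleared, both sides are images of polynomials, equated by [eX] and
   [eY]. *)
by split; apply: (mulIf DF0); rewrite divfK //;
  rewrite -!(tofracXn, tofracM, tofracD, tofracB) (eX, eY).
Qed.
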